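(* Let $(X,\mathscr U)$ be a separated uniform space endowed with a graph $G$, let $p$ be an $E$-distance on $X$ such that $X$ is $p$-complete, and let $T:X\to X$ be an integral type $p$-$\widetilde G$-contraction. Suppose that at least one of the following holds: (i) $T$ is orbitally $p$-$\widetilde G$-continuous on $X$; (ii) the triple $(X,p,G)$ has the property: whenever a sequence $\{x_n\}$ in $X$ is $p$-convergent to some $x\in X$ and satisfies $(x_n,x_{n+1})\in E(\widetilde G)$ for all $n\ge 1$, there exists a subsequence $\{x_{n_k}\}$ of $\{x_n\}$ such that $(x_{n_k},x)\in E(\widetilde G)$ for all $k\ge 1$. Then $T|_{C_T}$ is a weakly $p$-Picard operator. In particular, if (i) or (ii) holds, then $\mathrm{Fix}(T)\neq\emptyset$ if and only if $C_T\neq\emptyset$.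
   Context: A uniform space is a nonempty set $X$ with a uniformity $\mathscr U$; it is separated if the intersection of all members of $\mathscr U$ is the diagonal $\Delta(X)=\{(x,x):x\in X\}$. A function $p:X\times X\to[0,+\infty)$ is an $E$-distance on $X$ if (i) for each $V\in\mathscr U$ there is $\delta>0$ such that for all $x,y,z\in X$, $p(z,x)\le\delta$ and $p(z,y)\le\delta$ imply $(x,y)\in V$; and (ii) $p(x,y)\le p(x,z)+p(z,y)$ for all $x,y,z\in X$. (No symmetry of $p$ and no condition $p(x,x)=0$ is assumed.) A sequence $\{x_n\}$ is $p$-convergent to $x$, written $x_n\stackrel{p}{\longrightarrow}x$, if $p(x_n,x)\to0$; it is $p$-Cauchy if $p(x_m,x_n)\to0$ as $m,n\to\infty$. $X$ is $p$-complete if every $p$-Cauchy sequence in $X$ is $p$-convergent to some point of $X$. A graph $G$ on $X$ is a directed graph without parallel edges with vertex set $V(G)=X$ and edge set $E(G)\subseteq X\times X$ containing all loops, i.e. $E(G)\supseteq\Delta(X)$. $\widetilde G$ is the graph with $V(\widetilde G)=X$ and $E(\widetilde G)=\{(x,y): (x,y)\in E(G)\text{ or }(y,x)\in E(G)\}$. $\Phi$ is the class of functions $\varphi:[0,+\infty)\to[0,+\infty)$ that are Lebesgue-integrable on $[0,+\infty)$, in the sense that $\varphi$ is Lebesgue measurable and the value of the integral over $[0,+\infty)$ is allowed to be $+\infty$, and such that $\int_0^\varepsilon\varphi(t)\,dt$ is positive and finite for every $\varepsilon>0$. For a graph $H$ on $X$ (with all loops), $T:X\to X$ is an integral type $p$-$H$-contraction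 if (IC1) $(x,y)\in E(H)$ implies $(Tx,Ty)\in E(H)$; and (IC2) there exist $\varphi\in\Phi$ and $\alpha\in(0,1)$ such that $\int_0^{p(Tx,Ty)}\varphi(t)\,dt\le\alpha\int_0^{p(x,y)}\varphi(t)\,dt$ for all $x,y\in X$ with $(x,y)\in E(H)$. An integral type $p$-$\widetilde G$-contraction is the case $H=\widetilde G$. $T$ is orbitally $p$-$H$-continuous on $X$ if for all $x,y\in X$ and all sequences $\{a_n\}$ of positive integers with $(T^{a_n}x,T^{a_{n+1}}x)\in E(H)$ for all $n\ge1$, $T^{a_n}x\stackrel{p}{\longrightarrow}y$ implies $T(T^{a_n}x)\stackrel{p}{\longrightarrow}Ty$. $\mathrm{Fix}(T)$ is the set of fixed points of $T$, and $C_T=\{x\in X:(T^nx,T^mx)\in E(\widetilde G)\text{ for all }m,n\ge0\}$ (with $T^0x=x$); $T$ maps $C_T$ into itself. A self-mapping $S$ of a set $Y\subseteq X$ is a weakly $p$-Picard operator if for every $y\in Y$ the sequence $\{S^ny\}$ is $p$-convergent to a fixed point of $S$ (vacuously true if $Y=\emptyset$). *)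

(* Defs.v *)
From HB Require Import structures.
From mathcomp Require Import all_boot all_order all_algebra.
From mathcomp Require Import all_classical all_reals all_analysis.

Set Implicit Arguments.
Unset Strict Implicit.
Unset Printing Implicit Defensive.

Import Order.TTheory GRing.Theory Num.Theory.
Import numFieldNormedType.Exports.

Local Open Scope classical_set_scope.
Local Open Scope ring_scope.

Definition separated_uniform (X : uniformType) : Prop :=
  \bigcap_(V in @entourage X) V = diagonal.

Record edistance (R : realType) (X : uniformType) (p : X -> X -> R) : Prop :=
  Edistance {
    edistance_ge0 : forall x y, 0 <= p x y;
    edistance_entourage : forall V : set (X * X), entourage V ->
      exists2 delta : R, 0 < delta &
        forall x y z, p z x <= delta -> p z y <= delta -> V (x, y);
    edistance_triangle : forall x y z, p x y <= p x z + p z y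
  }.

(* Sequences are indexed from 0, also where the usual convention is n >= 1. *)

(* p need not be symmetric: the limit is always the second argument. *)
Definition pconverges (R : realType) (X : Type) (p : X -> X -> R)
    (u : nat -> X) (l : X) : Prop :=
  p (u n) l @[n --> \oo] --> (0 : R).

Definition pcauchy (R : realType) (X : Type) (p : X -> X -> R)
    (u : nat -> X) : Prop :=
  p (u mn.1) (u mn.2) @[mn --> (\oo, \oo)] --> (0 : R).

Definition pcomplete (R : realType) (X : Type) (p : X -> X -> R) : Prop :=
  forall u : nat -> X, pcauchy p u -> exists l, pconverges p u l.

Record graph (X : Type) := Graph {
  edges : set (X * X);
  graph_loops : diagonal `<=` edges
}.

Lemma undirected_loops (X : Type) (G : graph X) :
  diagonal `<=` edges G `|` (edges G)^-1%relation.
Proof. by move=> xy xy_diag; left; exact: graph_loops. Qed.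

Definition undirected (X : Type) (G : graph X) : graph X :=
  Graph (@undirected_loops X G).

(* The line carrying the completed Lebesgue measure: measurability for this
   type is Lebesgue (not only Borel) measurability, by
   completed_caratheodory_measurable. *)
Definition lebesgueType (R : realType) :=
  caratheodory_type (wlength (@idfun R))^*%mu.

(* A function on the half-line is represented by a total function whose
   values on the negative reals are never used. *)
Record integral_gauge (R : realType) (phi : R -> R) : Prop := IntegralGauge {
  integral_gauge_ge0 : forall t, 0 <= t -> 0 <= phi t;
  integral_gauge_measurable :
    measurable_fun (`[0, +oo[ : set (lebesgueType R)) phi;
  integral_gauge_lty : forall e : R, 0 < e ->
    (0 < \int[@completed_lebesgue_measure R]_(t in `[0%R, e]) (phi t)%:E < +oo)%E
}.

Record integral_contraction (R : realType) (X : Type) (p : X -> X -> R)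
    (H : graph X) (T : X -> X) : Prop := IntegralContraction {
  integral_contraction_edges :
    forall x y, edges H (x, y) -> edges H (T x, T y);
  integral_contraction_le :
    exists (phi : R -> R) (alpha : R),
      [/\ integral_gauge phi, 0 < alpha < 1 &
          forall x y, edges H (x, y) ->
            (\int[@completed_lebesgue_measure R]_(t in `[0%R, p (T x) (T y)])
                (phi t)%:E
             <= alpha%:E *
                \int[@completed_lebesgue_measure R]_(t in `[0%R, p x y])
                  (phi t)%:E)%E]
}.

(* The exponents a n are not required to be increasing. *)
Definition orbitally_continuous (R : realType) (X : Type) (p : X -> X -> R)
    (H : graph X) (T : X -> X) : Prop :=
  forall (x y : X) (a : nat -> nat),
    (forall n, (0 < a n)%N) ->
    (forall n, edges H (iter (a n) T x, iter (a n.+1) T x)) ->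
    pconverges p (fun n => iter (a n) T x) y ->
    pconverges p (fun n => T (iter (a n) T x)) (T y).

Definition subsequence_property (R : realType) (X : Type) (p : X -> X -> R)
    (G : graph X) : Prop :=
  forall (u : nat -> X) (x : X),
    pconverges p u x ->
    (forall n, edges (undirected G) (u n, u n.+1)) ->
    exists2 k : nat -> nat, increasing_seq k &
      forall n, edges (undirected G) (u (k n), x).

Definition Fix (X : Type) (T : X -> X) : set X := [set x | T x = x].

Definition orbit_clique (X : Type) (G : graph X) (T : X -> X) : set X :=
  [set x | forall m n, edges (undirected G) (iter n T x, iter m T x)].

(* The restriction to Y of S is a self-mapping of Y (first component) and is
   weakly p-Picard; its fixed points are those of S lying in Y. *)
Definition weakly_picard_on (R : realType) (X : Type) (p : X -> X -> R)
    (Y : set X) (S : X -> X) : Prop :=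
  set_fun Y Y S /\
  forall y, Y y ->
    exists2 z, (Y `&` Fix S) z & pconverges p (fun n => iter n S y) z.

(* Main.v *)
(* If F(r) denotes the integral of phi over [0, r], then F is nondecreasing,
   positive for r > 0 and right-continuous, so alpha F(e + h) < F(e) for some
   h > 0. Hence T satisfies a Meir-Keeler condition: along an edge,
   p x y < e + h forces p (T x) (T y) < e. This alone makes the double sequence
   p (T^m x) (T^n x) tend to 0 for x in C_T. If z is the p-limit of the orbit,
   then some T^n x is p-close to both z and T z, by (i) or, under (ii), by the
   Meir-Keeler condition along the edges (T^(k n) x, z); separatedness gives
   T z = z. *)
Require Import Defs.
From HB Require Import structures.
From mathcomp Require Import all_boot all_order all_algebra.
From mathcomp Require Import all_classical all_reals all_analysis.
From mathcomp Require Import measurable_realfun.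

Set Implicit Arguments.
Unset Strict Implicit.
Unset Printing Implicit Defensive.

Import Order.TTheory GRing.Theory Num.Theory.
Import numFieldNormedType.Exports.

Local Open Scope classical_set_scope.
Local Open Scope ring_scope.

(** * Right-continuity of the gauge integral *)

(** Dominated convergence for the restrictions [f \_ (F n)] on [F 0], with dominating function
    [|f|]: as the sets are nested, these restrictions are eventually constant at each point. *)
Lemma nonincreasing_set_cvg_integral (d : measure_display)
    (T : measurableType d) (R : realType) (mu : {measure set T -> \bar R})
    (F : (set T)^nat) (f : T -> \bar R) :
  {homo F : m n / (m <= n)%N >-> n `<=` m} ->
  (forall n, measurable (F n)) ->
  (forall x, F 0%N x -> f x \is a fin_num) ->
  mu.-integrable (F 0%N) f ->
  (\int[mu]_(x in F n) f x)%E @[n --> \oo] -->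
    (\int[mu]_(x in \bigcap_n F n) f x)%E.
Proof.
move=> F_noninc F_meas f_fin f_int.
have F0 n : F n `<=` F 0%N by exact: F_noninc.
have /measurable_int f_meas := f_int.
have -> : (fun n => (\int[mu]_(x in F n) f x)%E) =
          (fun n => (\int[mu]_(x in F 0%N) (f \_ (F n)) x)%E).
  by apply/funext => n; rewrite -integral_mkcondr setIidr.
rewrite -[X in (\int[mu]_(x in X) f x)%E](@setIidr _ (F 0%N)); last first.
  exact: bigcap_inf.
rewrite integral_mkcondr.
apply: (@dominated_cvg _ _ _ mu _ _ _ _ (abse \o f)) => //=.
- move=> n; apply/measurable_restrict => //.
  by apply: measurable_funS f_meas => //; exact: subIsetr.
- move=> x F0x; rewrite patchE; case: ifPn => [|];
    rewrite ?inE ?notin_setE => Fx.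
    apply: cvg_near_cst; near=> n.
    by rewrite patchE ifT// inE; exact: Fx.
  have [k Fkx] : exists k, ~ F k x.
    by apply/existsNP => Fx'; apply: Fx => n _.
  apply: cvg_near_cst; near=> n.
  rewrite patchE ifF//; apply/negbTE; rewrite notin_setE => /F_noninc-/(_ k) Fk.
  by apply: Fkx; apply: Fk; near: n; exact: nbhs_infty_ge.
- by move=> x F0x; rewrite fin_num_abs abse_id -fin_num_abs; exact: f_fin.
- exact: integrable_abse.
- move=> n x F0x; rewrite patchE; case: ifPn => // _.
  by rewrite abse0.
Unshelve. all: by end_near. Qed.

Lemma lebesgueType_measurable_itv (R : realType) (i : interval R) :
  measurable ([set` i] : set (lebesgueType R)).
Proof. by apply: sub_caratheodory; exact: measurable_itv. Qed.

Section gauge_integral.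
Variables (R : realType) (phi : R -> R).
Hypothesis phi_gauge : integral_gauge phi.

Definition gauge_integral (r : R) : \bar R :=
  (\int[@completed_lebesgue_measure R]_(t in `[0%R, r]) (phi t)%:E)%E.

Let phi_measurable r :
  measurable_fun (`[0, r] : set (lebesgueType R)) (EFin \o phi).
Proof.
apply/measurable_EFinP.
apply: measurable_funS (integral_gauge_measurable phi_gauge).
  exact: lebesgueType_measurable_itv.
by move=> t /=; rewrite !in_itv/= andbT => /andP[].
Qed.

Lemma gauge_integral_le r s :
  r <= s -> (gauge_integral r <= gauge_integral s)%E.
Proof.
move=> rs; apply: ge0_subset_integral.
- exact: lebesgueType_measurable_itv.
- exact: lebesgueType_measurable_itv.
- exact: phi_measurable.
- move=> t /=; rewrite in_itv/= => /andP[t0 _].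
  by rewrite lee_fin (integral_gauge_ge0 phi_gauge).
- by move=> t /=; rewrite !in_itv/= => /andP[-> /le_trans]; exact.
Qed.

Lemma gauge_integral_right_cvg e : 0 < e ->
  gauge_integral (e + n.+1%:R^-1) @[n --> \oo] --> gauge_integral e.
Proof.
move=> e0; rewrite /gauge_integral.
have -> : `[0, e]%classic = \bigcap_n `[0, e + n.+1%:R^-1]%classic.
  apply/seteqP; split => t /=.
    by rewrite in_itv/= => /andP[t0 te] n _ /=; rewrite in_itv/= t0 ler_wpDr.
  move=> ht; have := ht 0%N I; rewrite /= !in_itv/= => /andP[-> _] /=.
  apply/ler_addgt0Pr => h h0.
  near \oo => n.
  have := ht n I; rewrite /= in_itv/= => /andP[_ /le_trans]; apply.
  rewrite lerD2l; apply/ltW; near: n; exact: near_infty_natSinv_lt (PosNum h0).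
apply: nonincreasing_set_cvg_integral => //=.
- move=> m n mn t /=; rewrite !in_itv/= => /andP[-> /le_trans]; apply.
  by rewrite lerD2l lef_pV2 ?posrE// ler_nat.
- by move=> n; exact: lebesgueType_measurable_itv.
- apply/integrableP; split; first exact: phi_measurable.
  under eq_integral => t.
    rewrite inE/= in_itv/= => /andP[t0 _].
    rewrite ger0_norm ?(integral_gauge_ge0 phi_gauge)//.
    over.
  (* The largest interval, at [n = 0], is [[0, e + 1]]; finiteness of the gauge integral there gives
     integrability. *)
  have /andP[_] := integral_gauge_lty phi_gauge (addr_gt0 e0 (@ltr01 R)).
  by rewrite invr1.
Unshelve. all: by end_near. Qed.

End gauge_integral.

(** * From the integral inequality to a Meir-Keeler condition *)

(** Unlike in the classical condition, [p x y] has no lower bound [e]; hence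
    [p (T x) (T y) <= p x y] along edges, even when [p x y = 0]. *)
Definition meir_keeler_contraction (R : realType) (X : Type) (p : X -> X -> R)
    (H : graph X) (T : X -> X) : Prop :=
  forall e : R, 0 < e -> exists2 h : R, 0 < h &
    forall x y, edges H (x, y) -> p x y < e + h -> p (T x) (T y) < e.

Lemma integral_contraction_meir_keeler (R : realType) (X : Type)
    (p : X -> X -> R) (H : graph X) (T : X -> X) :
  integral_contraction p H T -> meir_keeler_contraction p H T.
Proof.
case=> _ [phi [a [phi_gauge /andP[a0 a1] T_le]]] e e0.
pose F := gauge_integral phi.
have /andP[Fe0 Fey] : (0 < F e < +oo)%E := integral_gauge_lty phi_gauge e0.
have [n Fn] : exists n, (a%:E * F (e + n.+1%:R^-1)%R < F e)%E.
  have aF : (a%:E * F (e + n.+1%:R^-1)%R)%E @[n --> \oo] --> (a%:E * F e)%E.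
    by apply: cvgeZl => //; exact: gauge_integral_right_cvg.
  have aFe : (a%:E * F e < F e)%E.
    have Fe_fin : F e \is a fin_num by rewrite ge0_fin_numE// ltW.
    rewrite -(fineK Fe_fin) -EFinM lte_fin gtr_pMl//.
    by rewrite -lte_fin fineK.
  have [n _ /(_ n (leqnn n))] := aF _ (open_ereal_lt' aFe).
  by exists n.
exists n.+1%:R^-1 => // x y xy pxy.
rewrite ltNge; apply/negP => epT.
(* If [e <= p (T x) (T y)], then [F e <= F (p (T x) (T y)) <= a F (p x y) <= a F (e + h) < F e],
   where [h] is the inverse of [n.+1]. *)
suff : (F e < F e)%E by rewrite ltxx.
apply: le_lt_trans (gauge_integral_le phi_gauge epT) _.
apply: le_lt_trans (T_le _ _ xy) _; apply: le_lt_trans Fn.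
apply: lee_wpmul2l; first by rewrite lee_fin ltW.
exact: gauge_integral_le (ltW pxy).
Qed.

(** * Real sequences and double sequences of Meir-Keeler type *)

Section meir_keeler_sequences.
Variable R : realType.

(** The sequence is nonincreasing, and its infimum [c] is [0]: if [c > 0], some [s n < c + h] would
    force [s n.+1 < c]. *)
Lemma meir_keeler_seq_vanish (s : nat -> R) :
  (forall n, 0 <= s n) ->
  (forall e, 0 < e -> exists2 h, 0 < h &
    forall n, s n < e + h -> s n.+1 < e) ->
  forall e, 0 < e -> exists N, forall n, (N <= n)%N -> s n < e.
Proof.
move=> s0 s_mk.
have s_le n : s n.+1 <= s n.
  apply/ler_addgt0Pr => h h0.
  (* The level must be positive while [s n] may be [0], so the condition is used at [s n + h] for
     arbitrary [h > 0]. *)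
  have snh : 0 < s n + h by exact: ltr_wpDl.
  have [h' h'0 /(_ n) s_lt] := s_mk _ snh.
  by apply/ltW/s_lt; rewrite -addrA ltrDl addr_gt0.
have s_noninc m n : (m <= n)%N -> s n <= s m.
  by move=> /subnK <-; elim: (n - m)%N => // k; apply: le_trans; exact: s_le.
have s_lb : has_lbound (range s) by exists 0 => _ [n _ <-].
have s_inf : has_inf (range s) by split => //; exists (s 0%N), 0%N.
have inf_ge0 : 0 <= inf (range s).
  by apply: lb_le_inf; [exact: s_inf.1|move=> _ [n _ <-]].
suff inf0 : inf (range s) = 0.
  move=> e e0; have [_ [N _ <-]] := inf_adherent e0 s_inf.
  by rewrite inf0 add0r => sN; exists N => n /s_noninc/le_lt_trans; exact.
apply/eqP; rewrite eq_le inf_ge0 andbT leNgt; apply/negP => inf_gt0.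
have [h h0 s_lt] := s_mk _ inf_gt0.
have [_ [n _ <-] /s_lt] := inf_adherent h0 s_inf.
by rewrite ltNge => /negP; apply; apply: ge_inf => //; exists n.+1.
Qed.

(* Meir-Keeler at [e / 2] keeps [d n (n + k)] below [e / 2 + h] for all [k] once
   [d n n.+1 < h]: the shifted pair [d n.+1 (n + k).+1] drops below [e / 2]. *)
Lemma meir_keeler_double_seq_half (d : nat -> nat -> R) :
  (forall m n, 0 <= d m n) ->
  (forall m n k, d m n <= d m k + d k n) ->
  (forall e, 0 < e -> exists2 h, 0 < h &
    forall m n, d m n < e + h -> d m.+1 n.+1 < e) ->
  forall e, 0 < e -> exists N, forall n k, (N <= n)%N -> d n (n + k)%N < e.
Proof.
move=> d0 d_tri d_mk e e0.
have e20 : 0 < e / 2 by rewrite divr_gt0.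
have vanish k : forall e', 0 < e' ->
    exists N, forall n, (N <= n)%N -> d n (n + k)%N < e'.
  apply: meir_keeler_seq_vanish => // e' /d_mk[h h0 d_lt].
  by exists h => // n /d_lt; rewrite addSn.
have [h h0 d_lt] := d_mk _ e20.
have h'0 : 0 < Num.min h (e / 2) by rewrite lt_min h0.
(* [d n n] need not be [0], so the base case [k = 0] of the induction needs the diagonal to tend to
   [0]. *)
have [N0 dN0] := vanish 0%N _ e20.
have [N1 dN1] := vanish 1%N _ h'0.
exists (maxn N0 N1) => n k; rewrite geq_max => /andP[N0n N1n].
suff dk : d n (n + k)%N < e / 2 + Num.min h (e / 2).
  apply: lt_le_trans dk _; rewrite [leRHS](splitr e) lerD2l.
  by rewrite ge_min lexx orbT.
elim: k => [|k IHk]; first by rewrite ltr_wpDr ?dN0 // ltW.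
apply: le_lt_trans (d_tri _ _ n.+1) _.
rewrite addrC addnS ltrD//; last by rewrite -addn1 dN1.
by apply: d_lt; apply: lt_le_trans IHk _; rewrite lerD2l ge_min lexx.
Qed.

(** Without symmetry, the two sides of the diagonal are treated separately: the hypotheses pass to
    the transpose of [d], the triangle inequality with its summands swapped. *)
Lemma meir_keeler_double_seq_vanish (d : nat -> nat -> R) :
  (forall m n, 0 <= d m n) ->
  (forall m n k, d m n <= d m k + d k n) ->
  (forall e, 0 < e -> exists2 h, 0 < h &
    forall m n, d m n < e + h -> d m.+1 n.+1 < e) ->
  forall e, 0 < e ->
    exists N, forall m n, (N <= m)%N -> (N <= n)%N -> d m n < e.
Proof.
move=> d0 d_tri d_mk e e0.
have [N1 dN1] := meir_keeler_double_seq_half d0 d_tri d_mk e0.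
have [N2 dN2] : exists N, forall n k, (N <= n)%N -> d (n + k)%N n < e.
  apply: (@meir_keeler_double_seq_half (fun m n => d n m)) => //.
    by move=> m n k; rewrite addrC.
  by move=> e' /d_mk[h h0 d_lt]; exists h => // m n; exact: d_lt.
exists (maxn N1 N2) => m n; rewrite !geq_max => /andP[N1m N2m] /andP[N1n N2n].
have [mn|/ltnW nm] := leqP m n; first by rewrite -(subnKC mn) dN1.
by rewrite -(subnKC nm) dN2.
Qed.

End meir_keeler_sequences.

(** * Limits and separation for an E-distance *)

Section edistance_limits.
Variables (R : realType) (X : uniformType) (p : X -> X -> R).
Hypothesis p_edistance : edistance p.

Lemma pconvergesP (u : nat -> X) (l : X) :
  pconverges p u l <->
  forall e, 0 < e -> exists N, forall n, (N <= n)%N -> p (u n) l < e.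
Proof.
split=> [/cvgr0Pnorm_lt u_l e /u_l[N _ uN]|u_l].
  by exists N => n /uN; rewrite ger0_norm// (edistance_ge0 p_edistance).
apply/cvgr0Pnorm_lt => e /u_l[N uN]; exists N => // n /uN.
by rewrite ger0_norm// (edistance_ge0 p_edistance).
Qed.

Lemma pcauchy_lt (u : nat -> X) :
  (forall e, 0 < e ->
    exists N, forall m n, (N <= m)%N -> (N <= n)%N -> p (u m) (u n) < e) ->
  pcauchy p u.
Proof.
move=> u_cauchy; apply/cvgr0Pnorm_lt => e /u_cauchy[N uN].
exists ([set n | (N <= n)%N], [set n | (N <= n)%N]).
  by split; exact: nbhs_infty_ge.
move=> [m n] [/= Nm Nn].
by rewrite ger0_norm ?(edistance_ge0 p_edistance)// uN.
Qed.

(** A common point [w], depending on [e], puts [(y, z)] in any given entourage; [w] is always the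
    first argument, so symmetry of [p] never enters. *)
Lemma edistance_eq (y z : X) :
  separated_uniform X ->
  (forall e, 0 < e -> exists2 w, p w y < e & p w z < e) -> y = z.
Proof.
move=> X_sep yz.
suff : (\bigcap_(V in @entourage X) V) (y, z) by rewrite X_sep.
move=> V /(edistance_entourage p_edistance)[e e0]; have [w wy wz] := yz _ e0.
by move=> pV; exact: pV (ltW wy) (ltW wz).
Qed.

End edistance_limits.

(** * Orbits of points of [C_T] *)

Lemma orbit_clique_stable (X : Type) (G : graph X) (T : X -> X) :
  set_fun (orbit_clique G T) (orbit_clique G T) T.
Proof. by move=> x x_clique m n; rewrite -!iterSr; exact: x_clique. Qed.

(** The orbit of a fixed point is constant, so only loops are required. This places the limits of
    orbits back in [C_T]. *)
Lemma Fix_sub_orbit_clique (X : Type) (G : graph X) (T : X -> X) :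
  Fix T `<=` orbit_clique G T.
Proof.
move=> x Tx m n; have iterT k : iter k T x = x by elim: k => //= k ->.
by rewrite !iterT; apply: graph_loops.
Qed.

Lemma meir_keeler_orbit_cauchy (R : realType) (X : uniformType) (G : graph X)
    (p : X -> X -> R) (T : X -> X) (x : X) :
  edistance p -> meir_keeler_contraction p (undirected G) T ->
  orbit_clique G T x -> pcauchy p (fun n => iter n T x).
Proof.
move=> p_edistance T_mk x_clique; apply: pcauchy_lt => //.
apply: meir_keeler_double_seq_vanish.
- by move=> m n; exact: (edistance_ge0 p_edistance).
- by move=> m n k; exact: (edistance_triangle p_edistance).
- move=> e /T_mk[h h0 T_lt]; exists h => // m n.
  exact/T_lt/x_clique.
Qed.

Lemma orbit_limit_fixed (R : realType) (X : uniformType) (G : graph X)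
    (p : X -> X -> R) (T : X -> X) (x z : X) :
  separated_uniform X -> edistance p ->
  meir_keeler_contraction p (undirected G) T ->
  orbitally_continuous p (undirected G) T \/ subsequence_property p G ->
  orbit_clique G T x -> pconverges p (fun n => iter n T x) z -> T z = z.
Proof.
move=> X_sep p_edistance T_mk T_or_G x_clique x_z.
have /(pconvergesP p_edistance) x_zP := x_z.
apply/esym/(edistance_eq p_edistance) => // e e0.
have [N xN] := x_zP _ e0.
case: T_or_G => [T_cont|G_sub].
  (* Orbital continuity asks for positive exponents, so it is applied to the orbit shifted by one,
     with exponents [n.+1]; applying [T] once more explains the index [.+2] below. *)
  have xS_z : pconverges p (fun n => iter n.+1 T x) z.
    apply/(pconvergesP p_edistance) => e' /x_zP[N' xN'].
    by exists N' => n N'n; apply: xN'; exact: leqW.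
  have /(pconvergesP p_edistance)/(_ _ e0)[M xM] :=
    T_cont x z S (fun=> isT) (fun n => x_clique _ _) xS_z.
  exists (iter (maxn N M).+2 T x); first by apply: xN; rewrite !leqW ?leq_maxl.
  by apply: xM; exact: leq_maxr.
have [k k_incr xk_z] := G_sub _ _ x_z (fun n => x_clique _ _).
have nk n : (n <= k n)%N.
  elim: n => // n /leq_ltn_trans; apply.
  by rewrite ltnNge -leEnat k_incr ltnn.
have [h h0 T_lt] := T_mk _ e0.
have [M xM] := x_zP _ (addr_gt0 e0 h0).
(* This point is close to [z] as a late term of the orbit, and close to [T z] as the image of a
   point joined to [z] by an edge and at distance below [e + h] from it. *)
exists (iter (k (maxn N M)).+1 T x).
  by apply: xN; rewrite leqW// (leq_trans _ (nk _))// leq_maxl.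
apply: T_lt (xk_z _) _; apply: xM.
by rewrite (leq_trans _ (nk _))// leq_maxr.
Qed.

Theorem theorem1 (R : realType) (X : uniformType) (G : graph X)
    (p : X -> X -> R) (T : X -> X)
    (X_nonempty : [set: X] !=set0)
    (X_separated : separated_uniform X)
    (p_edistance : edistance p)
    (X_pcomplete : pcomplete p)
    (T_contraction : integral_contraction p (undirected G) T)
    (T_or_G : orbitally_continuous p (undirected G) T \/
              subsequence_property p G) :
  weakly_picard_on p (orbit_clique G T) T /\
  (Fix T !=set0 <-> orbit_clique G T !=set0).
Proof.
have T_mk := integral_contraction_meir_keeler T_contraction.
have picard x : orbit_clique G T x ->
    exists2 z, Fix T z & pconverges p (fun n => iter n T x) z.
  move=> x_clique.
  have [z x_z] :=
    X_pcomplete _ (meir_keeler_orbit_cauchy p_edistance T_mk x_clique).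
  exists z; last exact: x_z.
  exact: (@orbit_limit_fixed _ _ G p T x z).
split.
  split; first exact: orbit_clique_stable.
  move=> x /picard[z Tz x_z]; exists z => //.
  by split => //; exact: (@Fix_sub_orbit_clique _ G T).
split=> [[x Tx]|[x /picard[z Tz _]]].
  by exists x; exact: (@Fix_sub_orbit_clique _ G T).
by exists z.
Qed.
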